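(* Let $G$ be a countable group containing the free group $F_2$ on two generators as a subgroup. Then the set of actions of $G$ on $C(2^{\mathbb{N}})$ by positive linear isometries that do not admit an equivalent $G$-invariant strictly convex norm is comeager in $\mathrm{Act}^+_G(C(2^{\mathbb{N}}))$.
   Context: $2^{\mathbb{N}}$ is the Cantor space and $C(2^{\mathbb{N}})$ the real Banach lattice of continuous functions on it with the sup norm. $\mathrm{LIso}(C(2^{\mathbb{N}}))$ is the group of surjective positive linear isometries with the strong operator topology, and $\mathrm{Act}^+_G(C(2^{\mathbb{N}}))$ is the set of homomorphisms $G\to\mathrm{LIso}(C(2^{\mathbb{N}}))$, viewed as a closed subset of $\mathrm{LIso}(C(2^{\mathbb{N}}))^G$ with the product topology. A norm is $G$-invariant if each $g$ acts isometrically for it; strictly convex if for $f\neq h$ of equal norm, $\|\frac{f+h}{2}\|<\|f\|$. *)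

(* Defs.v *)
From HB Require Import structures.
From mathcomp Require Import all_boot all_order all_algebra.
From mathcomp Require Import monoid.
From mathcomp Require Import all_classical all_reals all_analysis.
Import numFieldNormedType.Exports.
Set Implicit Arguments. Unset Strict Implicit. Unset Printing Implicit Defensive.
Import Order.TTheory GRing.Theory Num.Theory.
Local Open Scope classical_set_scope.
Local Open Scope ring_scope.

(* A letter of a word in the generators a, b: (generator, inverted?),
   generator false = a, true = b. *)
Definition letter := (bool * bool)%type.

Fixpoint reduced_word (w : seq letter) : Prop :=
  match w with
  | [::] => True
  | l :: w' =>
      match w' with
      | [::] => True
      | l' :: _ => ~ (l.1 = l'.1 /\ l.2 <> l'.2) /\ reduced_word w'
      end
  end.

Definition eval_letter (G : groupType) (a b : G) (l : letter) : G :=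
  let x := if l.1 then b else a in if l.2 then (x^-1)%g else x.

Fixpoint eval_word (G : groupType) (a b : G) (w : seq letter) : G :=
  match w with
  | [::] => 1%g
  | l :: w' => (eval_letter a b l * eval_word a b w')%g
  end.

(* a, b freely generate a free subgroup: the subgroup <a,b> is isomorphic to F_2
   via the canonical map from reduced words (the normal forms of F_2). *)
Definition free_pair (G : groupType) (a b : G) : Prop :=
  forall w : seq letter, w <> [::] -> reduced_word w -> eval_word a b w <> 1%g.

Definition contains_F2 (G : groupType) : Prop := exists a b : G, free_pair a b.

Definition CK (R : realType) := {f : cantor_space -> R | continuous f}.

Definition supn (R : realType) (f : cantor_space -> R) : R :=
  sup (range (fun x : cantor_space => `|f x|)).

Definition is_LIso (R : realType) (T : CK R -> CK R) : Prop :=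
  [/\
      (forall (c : R) (f g h : CK R),
          (forall x, sval h x = c * sval f x + sval g x) ->
          forall x, sval (T h) x = c * sval (T f) x + sval (T g) x),
      (forall f : CK R, (forall x, 0 <= sval f x) -> forall x, 0 <= sval (T f) x),
      (forall f g : CK R,
          supn (fun x => sval (T f) x - sval (T g) x) = supn (fun x => sval f x - sval g x))
    &
      (forall g : CK R, exists f, T f = g)].

Definition is_action (R : realType) (G : groupType) (rho : G -> CK R -> CK R) : Prop :=
  (forall g, is_LIso (rho g)) /\
  (forall g h (f : CK R), rho (g * h)%g f = rho g (rho h f)).

(* ---------- Topology of Act^+_G (subspace of the product of SOT) ---------- *)
Definition act_nbhd (R : realType) (G : groupType) (sigma : G -> CK R -> CK R)
    (n : nat) (gs : nat -> G) (fs : nat -> CK R) (e : R) : set (G -> CK R -> CK R) :=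
  [set rho | is_action rho /\
     forall i, (i < n)%N ->
       supn (fun x => sval (rho (gs i) (fs i)) x - sval (sigma (gs i) (fs i)) x) < e].

Definition act_open (R : realType) (G : groupType) (U : set (G -> CK R -> CK R)) : Prop :=
  (forall rho, U rho -> is_action rho) /\
  forall sigma, U sigma ->
    exists n gs fs e, 0 < e /\ act_nbhd sigma n gs fs e `<=` U.

Definition act_dense (R : realType) (G : groupType) (U : set (G -> CK R -> CK R)) : Prop :=
  forall sigma, is_action sigma -> forall n gs fs (e : R), 0 < e ->
    exists rho, U rho /\ act_nbhd sigma n gs fs e rho.

Definition act_comeager (R : realType) (G : groupType) (A : set (G -> CK R -> CK R)) : Prop :=
  exists U : nat -> set (G -> CK R -> CK R),
    (forall k, act_open (U k) /\ act_dense (U k)) /\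
    (forall rho, is_action rho -> (forall k, U k rho) -> A rho).

Definition is_norm (R : realType) (N : CK R -> R) : Prop :=
  [/\ (forall f, 0 <= N f),
      (forall f : CK R, N f = 0 -> forall x, sval f x = 0),
      (forall (c : R) (f g : CK R), (forall x, sval g x = c * sval f x) -> N g = `|c| * N f)
    & (forall f g h : CK R, (forall x, sval h x = sval f x + sval g x) -> N h <= N f + N g)].

Definition equivalent_to_sup (R : realType) (N : CK R -> R) : Prop :=
  exists c C : R, 0 < c /\ 0 < C /\
    forall f : CK R, c * supn (sval f) <= N f /\ N f <= C * supn (sval f).

Definition invariant_norm (R : realType) (G : groupType) (rho : G -> CK R -> CK R)
    (N : CK R -> R) : Prop :=
  forall g f, N (rho g f) = N f.

Definition strictly_convex (R : realType) (N : CK R -> R) : Prop :=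
  forall f h m : CK R, f <> h -> N f = N h ->
    (forall x, sval m x = (sval f x + sval h x) / 2) -> N m < N f.

Definition admits_inv_sc_norm (R : realType) (G : groupType) (rho : G -> CK R -> CK R) : Prop :=
  exists N : CK R -> R,
    [/\ is_norm N, equivalent_to_sup N, invariant_norm rho N & strictly_convex N].

(* Main.v *)
Require Import Defs.
From HB Require Import structures.
From mathcomp Require Import all_boot all_order all_algebra.
From mathcomp Require Import monoid.
From mathcomp Require Import all_classical all_reals all_analysis.
From mathcomp Require Import lra.
Import numFieldNormedType.Exports.
Set Implicit Arguments. Unset Strict Implicit. Unset Printing Implicit Defensive.
Import Order.TTheory GRing.Theory Num.Theory.
Local Open Scope classical_set_scope.
Local Open Scope ring_scope.

(* A strictly convex norm N cannot take the same value at f, at some h <> f and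
   at their midpoint, so an action rho admits no invariant such norm as soon as
   rho a f = (f + h) / 2 and rho b f = h for suitable f <> h. When f, h and
   their midpoint take values in {-1, 0, 1} this is an open condition, because
   rho g maps 0/1-valued functions to 0/1-valued functions; it suffices to see
   that it is also dense.

   Two homeomorphisms of the Cantor space realise it: f is supported on a
   clopen set, with a sign; b reverses the sign on a part of the support, and a
   shrinks the support to the remaining part. Coinducing this action of F_2
   gives an action alpha of G on the Cantor space L. An arbitrary action sigma
   on C(K) extends to C(K x L) by acting with sigma on K and with alpha on L,
   and transporting it along a homeomorphism K x L ~ K that preserves the first
   n coordinates of K yields, for large n, an action close to sigma. *)

(** * Prefix topology, uniform continuity and the sup norm *)

Definition agree (n : nat) (x y : cantor_space) : Prop :=
  forall i, (i < n)%N -> x i = y i.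

Lemma agree_le m n x y : (m <= n)%N -> agree n x y -> agree m x y.
Proof. by move=> mn xy i im; apply: xy; exact: leq_trans mn. Qed.

Lemma nbhs_bit (x : cantor_space) i : \forall y \near x, y i = x i.
Proof.
have /(_ [set x i]) := @proj_continuous nat (fun _ => bool) i x.
apply; exact: discrete_set1.
Qed.

Lemma nbhs_agree n (x : cantor_space) : nbhs x [set y | agree n x y].
Proof.
elim: n => [|n IHn]; first by apply: filterE.
near=> y => i; rewrite ltnS leq_eqVlt => /predU1P[->|].
  by near: y; apply: filterS (nbhs_bit x n).
by move: i; near: y.
Unshelve. all: by end_near. Qed.

(* By compactness: away from x some coordinate differs from that of x nearby. *)
Lemma nbhs_cantorP (x : cantor_space) (A : set cantor_space) :
  nbhs x A -> exists n, [set y | agree n x y] `<=` A.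
Proof.
move=> xA.
have := (compact_near_coveringP [set: cantor_space]).1 cantor_space_compact.
move=> /(_ nat \oo (fun n y => agree n x y -> A y) _)[].
  move=> y _; have [/funext xy|/existsNP[i xyi]] := pselect (forall i, x i = y i).
    rewrite -[y]xy; exists (A, setT); first by split=> //; exact: filterT.
    by move=> [z n] /= [].
  exists ([set z | z i = y i], [set n | (i < n)%N]).
    by split; [exact: nbhs_bit | exists i.+1].
  by move=> [z n] /= [zy ni] /(_ i ni) xz; case: xyi; rewrite xz.
by move=> n _ /(_ n (leqnn n)) nA; exists n => y xy; exact: nA.
Qed.

Lemma cantor_continuousP (R : realType) (f : cantor_space -> R) :
  continuous f <->
  forall x e, 0 < e -> exists n, forall y, agree n x y -> `|f x - f y| < e.
Proof.
split=> [fc x e e0|fc x].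
  by have /cvgrPdist_lt/(_ e e0)/nbhs_cantorP := fc x.
apply/cvgrPdist_lt => e /(fc x)[n xn].
exact: filterS xn (nbhs_agree n x).
Qed.

Lemma cantor_ucont (R : realType) (f : cantor_space -> R) (e : R) :
  continuous f -> 0 < e ->
  exists n, forall x y, agree n x y -> `|f x - f y| < e.
Proof.
move=> /cantor_continuousP fc e0.
have := (compact_near_coveringP [set: cantor_space]).1 cantor_space_compact.
move=> /(_ nat \oo (fun n x => forall y, agree n x y -> `|f x - f y| < e) _)[].
  move=> x _; have [N xN] := fc x _ (divr_gt0 e0 (ltr0n R 2)).
  exists ([set y | agree N x y], [set n | (N <= n)%N]).
    by split; [exact: nbhs_agree | exists N].
  move=> [y n] /= [xy Nn] z yz.
  have xz : agree N x z by move=> i iN; rewrite xy// yz// (leq_trans iN).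
  have := xN _ xy; have := xN _ xz.
  have := ler_distD (f x) (f y) (f z); rewrite (distrC (f y) (f x)).
  by move=> ? ? ?; lra.
by move=> n _ /(_ n (leqnn n)) fn; exists n => x y; exact: fn.
Qed.

Lemma CK_ext (R : realType) (f g : CK R) : (forall x, sval f x = sval g x) -> f = g.
Proof. by case: f g => [f fc] [g gc] /= /funext fg; apply: eq_exist. Qed.

Lemma supn_le (R : realType) (f : cantor_space -> R) (e : R) :
  (forall x, `|f x| <= e) -> supn f <= e.
Proof.
move=> fe; apply: ge_sup; first by exists `|f point|, point.
by move=> _ [x _ <-].
Qed.

Lemma le_supn (R : realType) (f : cantor_space -> R) x :
  continuous f -> `|f x| <= supn f.
Proof.
move=> fc; apply: ub_le_sup; last by exists x.
have [|M [_ /(_ (M + 1))]] :=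
  @compact_bounded _ R^o (f @` [set: cantor_space]).
  apply: continuous_compact cantor_space_compact.
  by apply: continuous_subspaceT.
rewrite ltrDl => /(_ ltr01) fM; exists (M + 1) => _ [y _ <-].
by apply: fM; exists y.
Qed.

Definition CK_cst (R : realType) (c : R) : CK R :=
  exist _ (fun=> c) (@cst_continuous _ _ c).

Definition CK_lin (R : realType) (c : R) (f g : CK R) : CK R.
Proof.
exists (fun x => c * sval f x + sval g x) => x.
apply: cvgD; last exact: (svalP g).
by apply: cvgM; [exact: cvg_cst | exact: (svalP f)].
Defined.

Definition CK_min (R : realType) (f g : CK R) : CK R.
Proof.
exists (fun x => Num.min (sval f x) (sval g x)) => x.
by apply: continuous_min; [exact: (svalP f)|exact: (svalP g)].
Defined.

Lemma CK_sub_continuous (R : realType) (f g : CK R) :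
  continuous (fun x => sval f x - sval g x).
Proof. by move=> x; apply: cvgB; [exact: (svalP f)|exact: (svalP g)]. Qed.

Lemma le_supnB (R : realType) (f g : CK R) x :
  `|sval f x - sval g x| <= supn (fun y => sval f y - sval g y).
Proof.
exact: (@le_supn R (fun y => sval f y - sval g y) x (@CK_sub_continuous R f g)).
Qed.

(** * Positive linear isometries *)

Section LIso.
Context (R : realType) (T : CK R -> CK R) (LT : is_LIso T).


Lemma LIso_lin c f g x : sval (T (CK_lin c f g)) x = c * sval (T f) x + sval (T g) x.
Proof. by case: LT => + _ _ _; apply. Qed.

Lemma LIso_sub (f g h : CK R) : (forall x, sval h x = sval f x - sval g x) ->
  forall x, sval (T h) x = sval (T f) x - sval (T g) x.
Proof.
case: LT => Tl _ _ _ fgh x.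
have E y : sval h y = -1 * sval g y + sval f y by rewrite fgh mulN1r addrC.
by rewrite (Tl _ _ _ _ E) mulN1r addrC.
Qed.

Lemma LIso_le (f g : CK R) : (forall x, sval f x <= sval g x) ->
  forall x, sval (T f) x <= sval (T g) x.
Proof.
move=> fg x; have Tp : forall f : CK R, _ := let: And4 _ p _ _ := LT in p.
have := Tp (CK_lin (-1) f g) _ x; rewrite LIso_lin mulN1r.
by rewrite addrC subr_ge0; apply => y /=; rewrite mulN1r addrC subr_ge0.
Qed.

Lemma LIso_dist (f g : CK R) (e : R) : (forall x, `|sval f x - sval g x| <= e) ->
  forall x, `|sval (T f) x - sval (T g) x| <= e.
Proof.
move=> fg x; apply: le_trans (le_supnB _ _ _) _.
by case: LT => _ _ -> _; exact: supn_le.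
Qed.

(** The isometry property gives T 1 <= 1. Conversely a preimage u of 1 has norm at most 1, so u <= 1
    and 1 = T u <= T 1. *)
Lemma LIso_cst (c : R) x : sval (T (CK_cst c)) x = c.
Proof.
have T0 y : sval (T (CK_cst 0)) y = 0.
  by rewrite (@LIso_sub (CK_cst 0) (CK_cst 0)) ?subrr// => z; rewrite /= subrr.
have T1 y : sval (T (CK_cst 1)) y = 1.
  have [u Tu] : exists u, T u = CK_cst 1 by case: LT => _ _ _; exact.
  have Tsup : forall f g : CK R, _ := let: And4 _ _ p _ := LT in p.
  have u1 z : sval u z <= 1.
    have := le_supnB u (CK_cst 0) z; rewrite -Tsup Tu /= subr0.
    move=> /(le_trans (ler_norm _))/le_trans; apply.
    by apply: supn_le => w; rewrite T0 /= subr0 normr1.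
  apply/eqP; rewrite eq_le; apply/andP; split.
    rewrite -[leLHS]subr0 -(T0 y); apply: le_trans (ler_norm _) _.
    by apply: LIso_dist => z; rewrite /= subr0 normr1.
  by have := @LIso_le u (CK_cst 1) u1 y; rewrite Tu.
have -> : CK_cst c = CK_lin c (CK_cst 1) (CK_cst 0).
  by apply: CK_ext => y /=; rewrite mulr1 addr0.
by rewrite LIso_lin T0 T1 mulr1 addr0.
Qed.

End LIso.

(** [rho 1] is idempotent and surjective, hence the identity. *)
Lemma action1 (R : realType) (G : groupType) (rho : G -> CK R -> CK R) f :
  is_action rho -> rho 1%g f = f.
Proof.
move=> [rL rM]; have [_ _ _ /(_ f)[h <-]] := rL 1%g.
by rewrite -rM mulg1.
Qed.

(** * Functions with values in {-1, 0, 1} and the open condition *)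

Definition indicator (R : realType) (f : CK R) : Prop :=
  forall x, sval f x = 0 \/ sval f x = 1.

(* [k = min (rho g e) (1 - rho g e)] is nonnegative and its image under the
   positive inverse [rho g^-1] lies below both [e] and [1 - e]. *)
Lemma action_indicator (R : realType) (G : groupType) (rho : G -> CK R -> CK R) g e :
  is_action rho -> indicator e -> indicator (rho g e).
Proof.
move=> ra ie; have rL := ra.1; have rM := ra.2.
pose e' := CK_lin (-1) e (CK_cst 1).
pose k := CK_min (rho g e) (rho g e').
have re' x : sval (rho g e') x = 1 - sval (rho g e) x.
  by rewrite (LIso_lin (rL g)) (LIso_cst (rL g)) mulN1r addrC.
have k0 x : sval k x <= 0.
  have -> : k = rho g (rho g^-1%g k) by rewrite -rM mulgV action1.
  rewrite -(LIso_cst (rL g) 0 x); apply: (LIso_le (rL g)) => y /=.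
  have ke : sval (rho g^-1%g k) y <= sval e y.
    rewrite -[e in leRHS](action1 _ ra) -(mulVg g) rM.
    by apply: (LIso_le (rL _)) => z; rewrite /= ge_min lexx.
  have ke' : sval (rho g^-1%g k) y <= sval e' y.
    rewrite -[e' in leRHS](action1 _ ra) -(mulVg g) rM.
    by apply: (LIso_le (rL _)) => z; rewrite /= ge_min lexx orbT.
  move: ke'; rewrite /= => ke'.
  by case: (ie y) => ey; rewrite ey in ke ke'; lra.
move=> x; have e0 : 0 <= sval (rho g e) x.
  rewrite -(LIso_cst (rL g) 0 x); apply: (LIso_le (rL g)) => y /=.
  by case: (ie y) => ->.
have e1 : sval (rho g e) x <= 1.
  rewrite -(LIso_cst (rL g) 1 x); apply: (LIso_le (rL g)) => y /=.
  by case: (ie y) => ->.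
have := k0 x; rewrite /= ge_min re' => /orP[] ?; [left|right]; lra.
Qed.

(** Having values in {-1, 0, 1}, encoded so that linearity carries the property through an
    action. *)
Definition indicator_diff (R : realType) (f : CK R) : Prop :=
  exists e e' : CK R, [/\ indicator e, indicator e' &
    forall x, sval f x = sval e x - sval e' x].

Lemma action_indicator_diff (R : realType) (G : groupType)
    (rho : G -> CK R -> CK R) g f :
  is_action rho -> indicator_diff f -> indicator_diff (rho g f).
Proof.
move=> ra [e [e' [ie ie' fe]]]; exists (rho g e), (rho g e').
split; [exact: action_indicator|exact: action_indicator|].
exact: (LIso_sub (ra.1 g)).
Qed.

(** Both functions are integer-valued, so a distance below 1 is 0. *)
Lemma indicator_diff_eq (R : realType) (f h : CK R) :
  indicator_diff f -> indicator_diff h ->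
  supn (fun x => sval f x - sval h x) < 1 -> f = h.
Proof.
move=> [e1 [e2 [i1 i2 fe]]] [e3 [e4 [i3 i4 he]]] fh1; apply: CK_ext => x.
have := le_lt_trans (le_supnB f h x) fh1; rewrite ltr_norml fe he.
by case: (i1 x) => ->; case: (i2 x) => ->; case: (i3 x) => ->; case: (i4 x) => ->;
  move=> /andP[] ? ?; lra.
Qed.

(* Once the strict inequalities force [rho a f = m] and [rho b f = h], every
   invariant norm takes the same value at [f], at [h] and at their midpoint. *)
Definition midpoint_orbit (R : realType) (G : groupType) (a b : G) :
    set (G -> CK R -> CK R) :=
  [set rho | is_action rho /\ exists f h m : CK R,
    [/\ [/\ indicator_diff f, indicator_diff h & indicator_diff m],
      f <> h, forall x, sval m x = (sval f x + sval h x) / 2,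
      supn (fun x => sval (rho a f) x - sval m x) < 1 &
      supn (fun x => sval (rho b f) x - sval h x) < 1]].

Lemma midpoint_orbit_no_norm (R : realType) (G : groupType) (a b : G)
    (rho : G -> CK R -> CK R) :
  midpoint_orbit a b rho -> ~ admits_inv_sc_norm rho.
Proof.
move=> [ra [f [h [m [[If Ih Im] fh mfh am bh]]]]] [N [_ _ Ninv Nsc]].
have Em : rho a f = m by apply: indicator_diff_eq => //; exact: action_indicator_diff.
have Eh : rho b f = h by apply: indicator_diff_eq => //; exact: action_indicator_diff.
have Nh : N f = N h by rewrite -Eh Ninv.
by have := Nsc f h m fh Nh mfh; rewrite -Em Ninv ltxx.
Qed.

Lemma supn_triangle (R : realType) (f g h : CK R) :
  supn (fun x => sval f x - sval h x) <=
  supn (fun x => sval f x - sval g x) + supn (fun x => sval g x - sval h x).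
Proof.
apply: supn_le => x; apply: le_trans (ler_distD (sval g x) _ _) _.
by apply: lerD; exact: le_supnB.
Qed.

Lemma midpoint_orbit_open (R : realType) (G : groupType) (a b : G) :
  act_open (@midpoint_orbit R G a b).
Proof.
split=> [rho []//|sigma [sa [f [h [m [I fh mfh am bh]]]]]].
(* An action within [1 - d] of [sigma] on [f] keeps both distances below 1. *)
pose d := Num.max (supn (fun x => sval (sigma a f) x - sval m x))
                  (supn (fun x => sval (sigma b f) x - sval h x)).
have d1 : d < 1 by rewrite gt_max am bh.
exists 2%N, (fun i => if i is 0%N then a else b), (fun=> f), (1 - d).
split=> [|rho [ra near]]; first by rewrite subr_gt0.
split=> //; exists f, h, m; split=> //.
- apply: le_lt_trans (supn_triangle _ (sigma a f) _) _.
  rewrite -[ltRHS](subrK d); apply: ltr_leD; first exact: (near 0%N).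
  by rewrite le_max lexx.
- apply: le_lt_trans (supn_triangle _ (sigma b f) _) _.
  rewrite -[ltRHS](subrK d); apply: ltr_leD; first exact: (near 1%N).
  by rewrite le_max lexx orbT.
Qed.

(** * Reduced words and normal forms in cosets of F_2 *)

Definition linv (l : letter) : letter := (l.1, ~~ l.2).

Lemma linvK : involutive linv.
Proof. by case=> x y; rewrite /linv /= negbK. Qed.

Lemma reduced_consP l w :
  reduced_word (l :: w) <-> ohead w <> Some (linv l) /\ reduced_word w.
Proof.
case: w => [|[x' y'] w] /=; first by split.
case: l => x y /=; split=> -[H ?]; split=> // E; apply: H.
  by case: E => -> ->; split=> //; case: y.
by case: E => <- ne; congr (Some (_, _)); move: ne; clear; case: y; case: y'.
Qed.

(** Left translation by a letter of F_2, on normal forms. *)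
Definition lmul (l : letter) (w : seq letter) :=
  if ohead w == Some (linv l) then behead w else l :: w.

Lemma reduced_lmul l w : reduced_word w -> reduced_word (lmul l w).
Proof.
rewrite /lmul; case: eqP => [_|wl wr]; last exact/reduced_consP.
by case: w => // l' w /reduced_consP[].
Qed.

Section normal_form.
Context (G : groupType) (a b : G).
Local Notation ev := (eval_word a b).

Lemma eval_linv l : eval_letter a b (linv l) = (eval_letter a b l)^-1%g.
Proof. by case: l => [] [] []; rewrite /eval_letter /= ?invgK. Qed.

Lemma eval_lmul l w : ev (lmul l w) = (eval_letter a b l * ev w)%g.
Proof.
rewrite /lmul; case: eqP => //; case: w => //= _ w [->].
by rewrite eval_linv mulVKg.
Qed.

Lemma eval_reduced w : exists2 w', reduced_word w' & ev w = ev w'.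
Proof.
elim: w => [|l w [w' rw' E]]; first by exists [::].
by exists (lmul l w'); [exact: reduced_lmul | rewrite eval_lmul /= E].
Qed.

(** Makes lying in the same coset of the subgroup generated by a and b a symmetric relation. *)
Lemma eval_mul_inv w z : exists w', (ev w' * (ev w * z) = z)%g.
Proof.
elim: w z => [|l w IHw] z /=; first by exists [::]; rewrite !mul1g.
have [w' E] := IHw z.
have [w2 E2] : exists w2, ev w2 = (ev w' * (eval_letter a b l)^-1)%g.
  exists (w' ++ [:: linv l]); elim: (w') => [|l' u IHu] /=.
    by rewrite eval_linv mulg1 mul1g.
  by rewrite IHu mulgA.
by exists w2; rewrite E2 -!mulgA mulKg.
Qed.

Context (fab : free_pair a b).

(** Moving the first letter of [w1] to the other side again gives reduced words with different
    heads; once [w1] is used up, freeness applies. *)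
Lemma eval_neq w1 w2 : reduced_word w1 -> reduced_word w2 ->
  ohead w1 <> ohead w2 -> ev w1 <> ev w2.
Proof.
elim: w1 w2 => [|l w1 IHw1] w2 r1 r2 /= d E.
  by case: w2 r2 d E => // l w2 r2 _ /esym; exact: fab.
have /reduced_consP[d1 r1'] := r1.
apply: (IHw1 (linv l :: w2)) => //.
- by apply/reduced_consP; rewrite linvK; split=> //; exact: nesym.
- by rewrite /= -E eval_linv mulKg.
Qed.

Lemma eval_inj w1 w2 : reduced_word w1 -> reduced_word w2 -> ev w1 = ev w2 -> w1 = w2.
Proof.
elim: w1 w2 => [|l w1 IHw1] w2 r1 r2 E.
  by case: w2 r2 E => // l w2 r2 /eval_neq; case.
case: w2 r2 E => [|l2 w2] r2 E; first by case: (eval_neq r1 r2 _ E).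
have [ll|/eqP ll] := eqVneq l l2; last first.
  by case: (eval_neq r1 r2 _ E) => -[].
move: r1 r2 E => /reduced_consP[_ r1] /reduced_consP[_ r2] /=.
by rewrite ll => /mulgI /(IHw1 _ r1 r2) ->.
Qed.

Lemma coset_normal_form : exists (r : G -> G) (w : G -> seq letter),
  [/\ forall z, z = (ev (w z) * r z)%g,
      forall z, reduced_word (w z),
      forall l z, r (eval_letter a b l * z)%g = r z,
      forall z, r (r z) = r z &
      forall l z, w (eval_letter a b l * z)%g = lmul l (w z)].
Proof.
pose C z := [set y | exists w, y = (ev w * z)%g].
(* The choice depends only on the set [C z], so [r] is constant on each coset. *)
pose r z := xget 1%g (C z).
have rC z : C z (r z) by apply: (@xgetPex _ 1%g (C z)); exists z, [::]; rewrite mul1g.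
have Cmul w z : C (ev w * z)%g = C z.
  apply/seteqP; split=> y [u ->].
    elim: u => [|l u [u' IHu]] /=; first by exists w; rewrite mul1g.
    by exists (l :: u'); rewrite -mulgA IHu /= mulgA.
  have [w' E] := eval_mul_inv w z.
  elim: u => [|l u [u' IHu]] /=; first by exists w'; rewrite mul1g E.
  by exists (l :: u'); rewrite -mulgA IHu /= mulgA.
have rmul w z : r (ev w * z)%g = r z by rewrite /r Cmul.
have rl l z : r (eval_letter a b l * z)%g = r z.
  by rewrite -[RHS](rmul [:: l]) /= mulg1.
have ex z : exists w, reduced_word w /\ z = (ev w * r z)%g.
  have [u Eu] := rC z; have [w' E] := eval_mul_inv u z.
  by have [w rw ww] := eval_reduced w'; exists w; split=> //; rewrite Eu -ww E.
have [w wP] := choice ex.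
exists r, w; split=> [z|z|//|z|l z]; [exact: (wP z).2|exact: (wP z).1| |].
  by have [u E] := rC z; rewrite [in LHS]E rmul.
apply: eval_inj; [exact: (wP _).1|exact/reduced_lmul/(wP _).1|].
apply: (@mulIg _ (r z)); rewrite eval_lmul -mulgA -(wP z).2 -(rl l z).
by rewrite -(wP _).2.
Qed.

End normal_form.

(** * Uniformly continuous maps and coinduction *)

Definition ucont (F : cantor_space -> cantor_space) : Prop :=
  forall n, exists N, forall x y, agree N x y -> agree n (F x) (F y).

Lemma ucont_comp F H : ucont F -> ucont H -> ucont (F \o H).
Proof.
move=> Fc Hc n; have [N FN] := Fc n; have [M HM] := Hc N.
by exists M => x y /HM/FN.
Qed.

Lemma ucont_bits F :
  (forall i, exists N, forall x y, agree N x y -> F x i = F y i) -> ucont F.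
Proof.
move=> Fb; elim=> [|n [N FN]]; first by exists 0%N.
have [M FM] := Fb n; exists (maxn N M) => x y xy i.
rewrite ltnS leq_eqVlt => /predU1P[->|].
  by apply: FM; apply: agree_le xy; rewrite leq_maxr.
by apply: FN; apply: agree_le xy; rewrite leq_maxl.
Qed.

Lemma ucont_reindex (s : nat -> nat) : ucont (fun x i => x (s i)).
Proof.
by apply: ucont_bits => i; exists (s i).+1 => x y; exact.
Qed.

(* Writing [z = ev (w z) * r z], a point x of the coinduced space is a map
   [X x : G -> cantor_space] with [X x (l * z) = V l (X x z)], determined by its
   values at the representatives [r z = z]; their coordinates are stored in x at
   the positions [io z j], and G acts by right translation of [X x]. The other
   positions of x are left fixed. *)
Lemma coinduced_action (G : groupType) (a b : G)
    (V : letter -> cantor_space -> cantor_space) :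
  countable [set: G] -> free_pair a b ->
  (forall l, cancel (V l) (V (linv l))) -> (forall l, ucont (V l)) ->
  exists (alpha : G -> cantor_space -> cantor_space) (p : cantor_space -> cantor_space),
  [/\ [/\ forall x, alpha 1%g x = x,
          forall g h x, alpha (g * h)%g x = alpha g (alpha h x) &
          forall g, ucont (alpha g)],
      ucont p, forall y, exists x, p x = y &
      forall l x, p (alpha (eval_letter a b l) x) = V l (p x)].
Proof.
move=> /countable_injP[c /in2TT cinj] fab VK Vc.
have [r [w [zE wr rl rr wl]]] := coset_normal_form fab.
pose io (z : G) (j : nat) := pickle (c z, j).
(* Decoding of positions; [None] marks those that store no coordinate of a representative. *)
have DP i : exists d : option (G * nat),
    if d is Some (z, j) then r z = z /\ i = io z j
    else forall z j, r z = z -> i <> io z j.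
  have [[[z j] ?]|H] := pselect (exists zj, r zj.1 = zj.1 /\ i = io zj.1 zj.2).
    by exists (Some (z, j)).
  by exists None => z j rz ij; apply: H; exists (z, j).
move: DP => /choice[D DP].
have Dio z j : r z = z -> D (io z j) = Some (z, j).
  move=> rz; have := DP (io z j); case: (D _) => [[z' j'] [_]|/(_ z j rz)//].
  by rewrite /io => /(pcan_inj pickleK)[/cinj -> ->].
have VK' l x : V l (V (linv l) x) = x by rewrite -{1}[l]linvK VK.
pose W u x := foldr V x u.
have Wc u : ucont (W u).
  by elim: u => [|l u IHu]; [move=> n; exists n | exact: (ucont_comp (Vc l))].
have Wl l u x : W (lmul l u) x = V l (W u x).
  rewrite /lmul; case: eqP => //; case: u => //= _ u [->].
  by rewrite VK'.
have Wsurj u y : exists x, W u x = y.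
  elim: u y => [|l u IHu] y; first by exists y.
  have [x Ex] := IHu (V (linv l) y); exists x.
  by rewrite /= Ex VK'.
pose X x z : cantor_space := W (w z) (fun j => x (io (r z) j)).
have Xl x l z : X x (eval_letter a b l * z)%g = V l (X x z).
  by rewrite /X wl rl Wl.
have Xw x u z : X x (eval_word a b u * z)%g = W u (X x z).
  by elim: u => [|l u IHu] /=; rewrite ?mul1g// -mulgA Xl IHu.
have Xc z : ucont (X^~ z) by exact: (ucont_comp (Wc (w z)) (@ucont_reindex (io (r z)))).
pose alpha g x : cantor_space :=
  fun i => if D i is Some (z, j) then X x (z * g)%g j else x i.
have Xa x g z : X (alpha g x) z = X x (z * g)%g.
  rewrite {2}[z]zE -mulgA Xw /X; congr W; apply/funext => j.
  by rewrite /alpha Dio.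
(* The map [p] evaluates [X x] at 1, and X x (1 * l) = X x (l * 1) = V l (X x 1). *)
exists alpha, (X^~ 1%g); split=> [|//|y|l x].
- split=> [x|g h x|g].
  + apply/funext => i; rewrite /alpha; have := DP i.
    case: (D i) => // -[z j] [rz ->]; rewrite mulg1 /X rz.
    (* Here z is its own representative, so freeness forces [w z] to be empty. *)
    have := wr z; case: (w z) (zE z) => // l u E /(fab _)[] //.
    by apply: (@mulIg _ (r z)); rewrite -E mul1g rz.
  + apply/funext => i; rewrite /alpha; case: (D i) => // -[z j].
    by rewrite -/(alpha h x) Xa mulgA.
  + apply: ucont_bits => i; rewrite /alpha; case: (D i) => [[z j]|]; last first.
      by exists i.+1 => x y; exact.
    by have [N XN] := Xc (z * g)%g j.+1; exists N => x y /XN; exact.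
- have [x Ex] := Wsurj (w 1%g) y.
  (* Every representative gets the same value x; only that of 1 matters. *)
  exists (fun i => if D i is Some (z, j) then x j else false).
  by rewrite -Ex /X; congr W; apply/funext => j; rewrite Dio.
- by rewrite Xa mul1g -[eval_letter a b l]mulg1 Xl.
Qed.

(** * The homeomorphisms given by the two generators *)

(* Coordinate 0 is the sign. On the other coordinates [squeeze] is the prefix
   exchange 10y -> 1y, 0y -> 00y, 11y -> 01y, and [stretch] its inverse. *)
Definition stretch (x : cantor_space) : cantor_space := fun i =>
  match i with
  | 0 => x 0%N
  | 1 => x 1%N || x 2%N
  | 2 => if x 1%N then false else if x 2%N then true else x 3%N
  | j.+3 => if x 1%N then x j.+2 else if x 2%N then x j.+3 else x j.+4
  end.

Definition squeeze (x : cantor_space) : cantor_space := fun i =>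
  match i with
  | 0 => x 0%N
  | 1 => x 1%N && ~~ x 2%N
  | 2 => if x 1%N then if x 2%N then true else x 3%N else false
  | j.+3 => if x 1%N then if x 2%N then x j.+3 else x j.+4 else x j.+2
  end.

(** The sign changes on prefix 11 only, so averaging a signed function supported on prefix 1 with
    its flip leaves the part on prefix 10, which [squeeze] maps onto prefix 1. *)
Definition flip (x : cantor_space) : cantor_space := fun i =>
  if i is 0 then x 0%N (+) (x 1%N && x 2%N) else x i.

(** The generator a moves points by [stretch], so it acts on functions by composition with
    [squeeze]. *)
Definition letter_act (l : letter) : cantor_space -> cantor_space :=
  if l.1 then flip else if l.2 then squeeze else stretch.

Lemma stretchK : cancel stretch squeeze.
Proof.
move=> x; apply/funext => -[|[|[|[|j]]]];
by rewrite /squeeze /stretch; case: (x 1%N) (erefl (x 1%N)) => /=;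
  case: (x 2%N) (erefl (x 2%N)) => /=.
Qed.

Lemma squeezeK : cancel squeeze stretch.
Proof.
move=> x; apply/funext => -[|[|[|[|j]]]];
by rewrite /squeeze /stretch; case: (x 1%N) (erefl (x 1%N)) => /=;
  case: (x 2%N) (erefl (x 2%N)) => /=.
Qed.

Lemma flipK : involutive flip.
Proof. by move=> x; apply/funext => -[|j] //=; rewrite -addbA addbb addbF. Qed.

Lemma letter_actK l : cancel (letter_act l) (letter_act (linv l)).
Proof. by case: l => [] [] []; [exact: flipK..|exact: squeezeK|exact: stretchK]. Qed.

Lemma letter_act_ucont l : ucont (letter_act l).
Proof.
(* Coordinate i of the image depends only on coordinates among 0 to 3 and i - 1 to i + 2. *)
apply: ucont_bits => i; exists i.+4 => x y xy.
have [E0 E1 E2 E3] : [/\ x 0%N = y 0%N, x 1%N = y 1%N, x 2%N = y 2%N & x 3%N = y 3%N].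
  by split; exact: xy.
have [E4 E5 E6 E7] : [/\ x i.-1 = y i.-1, x i = y i, x i.+1 = y i.+1 & x i.+2 = y i.+2].
  split; apply: xy; [|exact: (leq_addl 3)|exact: (leq_addl 2)|exact: (leq_addl 1)].
  exact: (leq_trans (leq_pred i) (leq_addl 3 i)).
by case: l => [] [] []; rewrite /letter_act /=;
  case: i {xy} E4 E5 E6 E7 => [|[|[|i]]] /= E4 E5 E6 E7;
  rewrite /squeeze /stretch /flip /= ?E0 ?E1 ?E2 ?E3 ?E4 ?E5 ?E6 ?E7.
Qed.

(** * Splitting the Cantor space as K x L *)

(** The homeomorphism K x L -> K: interleaving after a prefix of length n, with inverse ([lpart],
    [rpart]). *)
Definition mix n (y l : cantor_space) : cantor_space := fun i =>
  if (i < n)%N then y i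
  else if odd (i - n) then l (i - n)./2 else y (n + (i - n)./2)%N.

Definition lpart n (u : cantor_space) : cantor_space := fun i =>
  if (i < n)%N then u i else u (n + (i - n).*2)%N.

Definition rpart n (u : cantor_space) : cantor_space := fun i => u (n + i.*2.+1)%N.

Lemma lpart_mix n y l : lpart n (mix n y l) = y.
Proof.
apply/funext => i; rewrite /lpart /mix; case: ltnP => // ni.
by rewrite ltnNge leq_addr /= addKn odd_double doubleK subnKC.
Qed.

Lemma rpart_mix n y l : rpart n (mix n y l) = l.
Proof.
apply/funext => i; rewrite /rpart /mix.
by rewrite ltnNge leq_addr /= addKn /= odd_double /= uphalf_double.
Qed.

Lemma mix_parts n u : mix n (lpart n u) (rpart n u) = u.
Proof.
apply/funext => i; rewrite /mix /lpart /rpart; case: ltnP => // ni.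
rewrite ltnNge leq_addr /= addKn; case: ifP => o; congr u.
  by rewrite -[RHS](subnKC ni) -[in RHS](odd_double_half (i - n)) o.
by rewrite -[RHS](subnKC ni) -[in RHS](odd_double_half (i - n)) o.
Qed.

Lemma agree_mix n y l : agree n (mix n y l) y.
Proof. by move=> i; rewrite /mix => ->. Qed.

(** Coordinate i of [mix] reads an index at most i of y or l, so no precision is lost. *)
Lemma mix_agree n N y y' l l' : agree N y y' -> agree N l l' ->
  agree N (mix n y l) (mix n y' l').
Proof.
move=> yy ll i iN; rewrite /mix; case: ltnP => ni; first exact: yy.
have iN' : ((i - n)./2 + n < N)%N.
  apply: leq_ltn_trans iN; rewrite -[leqRHS](subnK ni) leq_add2r.
  by rewrite leq_half_double leqW -?addnn ?leq_addr.
case: ifP => _; first by apply: ll; apply: leq_ltn_trans iN'; rewrite leq_addr.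
by apply: yy; rewrite addnC.
Qed.

Lemma lpart_ucont n : ucont (lpart n).
Proof.
apply: ucont_bits => i; rewrite /lpart; case: (i < n)%N.
  by exists i.+1 => x y; exact.
by exists (n + (i - n).*2).+1 => x y; exact.
Qed.

Lemma rpart_ucont n : ucont (rpart n).
Proof. exact: ucont_reindex. Qed.

(** * Amplification of an action *)

(* [amplify] is the action sigma x alpha on C(K x L), read on K through the
   homeomorphism [mix n]. *)
Section amplification.
Context (R : realType) (G : groupType) (sigma : G -> CK R -> CK R)
  (sa : is_action sigma) (alpha : G -> cantor_space -> cantor_space)
  (alpha1 : forall x, alpha 1%g x = x)
  (alphaM : forall g h x, alpha (g * h)%g x = alpha g (alpha h x))
  (alphac : forall g, ucont (alpha g)) (n : nat).

Lemma slice_continuous (f : CK R) l : continuous (fun y => sval f (mix n y l)).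
Proof.
apply/cantor_continuousP => y e e0.
have [N fN] := cantor_ucont (svalP f) e0.
by exists N => z yz; apply: fN; apply: mix_agree.
Qed.

Definition slice (f : CK R) l : CK R := exist _ _ (@slice_continuous f l).

Lemma amplify_continuous g (f : CK R) : continuous (fun u =>
  sval (sigma g (slice f (alpha g^-1%g (rpart n u)))) (lpart n u)).
Proof.
apply/cantor_continuousP => u e e0.
have e20 : 0 < e / 2 by rewrite divr_gt0.
have [N fN] := cantor_ucont (svalP f) e20.
(* The slice is frozen at u: [s0] handles the change of the K coordinate, and the isometry [sigma g]
   transfers the uniform change of slice. *)
set s0 := sigma g (slice f (alpha g^-1%g (rpart n u))).
have [M sM] := cantor_ucont (svalP s0) e20.
have [N1 rN1] := ucont_comp (alphac g^-1%g) (@rpart_ucont n) N.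
have [M1 lM1] := lpart_ucont n M.
exists (maxn N1 M1) => v uv.
have /rN1 /= ruv : agree N1 u v by apply: agree_le uv; rewrite leq_maxl.
have /lM1/sM luv : agree M1 u v by apply: agree_le uv; rewrite leq_maxr.
apply: le_lt_trans (ler_distD (sval s0 (lpart n v)) _ _) _.
rewrite [ltRHS]splitr; apply: ltr_leD luv _.
apply: (LIso_dist (sa.1 g)) => y /=; apply: ltW; apply: fN.
by apply: mix_agree.
Qed.

Definition amplify g (f : CK R) : CK R := exist _ _ (@amplify_continuous g f).

Lemma slice_amplify g f l :
  slice (amplify g f) l = sigma g (slice f (alpha g^-1%g l)).
Proof. by apply: CK_ext => y /=; rewrite rpart_mix lpart_mix. Qed.

Lemma amplify1 f : amplify 1%g f = f.
Proof.
apply: CK_ext => u /=.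
by rewrite (action1 _ sa) invg1 alpha1 /= mix_parts.
Qed.

Lemma amplifyM g h f : amplify (g * h)%g f = amplify g (amplify h f).
Proof.
apply: CK_ext => u /=.
by rewrite slice_amplify sa.2 invgM alphaM.
Qed.

Lemma amplify_dist g f h :
  supn (fun x => sval (amplify g f) x - sval (amplify g h) x) <=
  supn (fun x => sval f x - sval h x).
Proof.
apply: supn_le => u /=; apply: (LIso_dist (sa.1 g)) => y /=.
exact: (le_supnB f h).
Qed.

Lemma amplify_action : is_action amplify.
Proof.
split=> [g|]; last exact: amplifyM.
have [sl sp _ _] := sa.1 g; split=> [c f h k E u|f f0 u|f h|h] /=.
- by apply: sl => y /=; exact: E.
- by apply: sp => y /=; exact: f0.
- apply/eqP; rewrite eq_le amplify_dist /=.
  (* The reverse inequality is the contraction estimate for the inverse of g. *)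
  rewrite -[f in leLHS]amplify1 -[h in leLHS]amplify1 -(mulVg g) !amplifyM.
  exact: amplify_dist.
- by exists (amplify g^-1%g h); rewrite -amplifyM mulgV amplify1.
Qed.

(** One e replaces each slice of f by f, the other moves the evaluation point from [lpart n u] to u,
    which has the same first n bits. *)
Lemma amplify_near g (f : CK R) (e : R) :
  (forall x y, agree n x y -> `|sval f x - sval f y| < e) ->
  (forall x y, agree n x y -> `|sval (sigma g f) x - sval (sigma g f) y| < e) ->
  supn (fun x => sval (amplify g f) x - sval (sigma g f) x) <= e + e.
Proof.
move=> fe sfe; apply: supn_le => u /=.
apply: le_trans (ler_distD (sval (sigma g f) (lpart n u)) _ _) _; apply: lerD.
  apply: (LIso_dist (sa.1 g)) => y /=; apply/ltW/fe; exact: agree_mix.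
apply/ltW/sfe => i ni; rewrite -[in RHS](mix_parts n u).
by rewrite agree_mix.
Qed.

(** A function of the L coordinate alone has constant slices, which [sigma] fixes; only [alpha] acts
    on it. *)
Lemma amplify_rpart g (f : CK R) (F : cantor_space -> R) :
  (forall u, sval f u = F (rpart n u)) ->
  forall u, sval (amplify g f) u = F (alpha g^-1%g (rpart n u)).
Proof.
move=> fF u /=; rewrite -[RHS](LIso_cst (sa.1 g) _ (lpart n u)).
congr (sval (sigma g _) _); apply: CK_ext => y /=.
by rewrite fF rpart_mix.
Qed.

End amplification.

(** * Density and the conclusion *)

Lemma common_modulus (R : realType) (fs : nat -> CK R) (k : nat) (e : R) : 0 < e ->
  exists n, forall i, (i < k)%N ->
  forall x y, agree n x y -> `|sval (fs i) x - sval (fs i) y| < e.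
Proof.
move=> e0; elim: k => [|k [n IHk]]; first by exists 0%N.
have [m fm] := cantor_ucont (svalP (fs k)) e0.
exists (maxn n m) => i; rewrite ltnS leq_eqVlt => /predU1P[->|ik] x y xy.
  by apply: fm; apply: agree_le xy; rewrite leq_maxr.
by apply: (IHk i ik); apply: agree_le xy; rewrite leq_maxl.
Qed.

Lemma bits_continuous (R : realType) F (B : bool -> bool -> bool) : ucont F ->
  continuous (fun u : cantor_space => (B (F u 0%N) (F u 1%N))%:R : R).
Proof.
move=> Fc; apply/cantor_continuousP => x e e0; have [N FN] := Fc 2%N.
by exists N => y /FN xy; rewrite !xy// subrr normr0.
Qed.

(** The function to be averaged: bit 1 gives the support, bit 0 the sign. *)
Definition signed_bit (R : realType) (x : cantor_space) : R :=
  (~~ x 0%N && x 1%N)%:R - (x 0%N && x 1%N)%:R.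

Lemma signed_bit_CK (R : realType) F : ucont F ->
  exists2 f : CK R, indicator_diff f & forall u, sval f u = signed_bit R (F u).
Proof.
move=> Fc.
pose e : CK R := exist _ _ (@bits_continuous R F (fun s t => ~~ s && t) Fc).
pose e' : CK R := exist _ _ (@bits_continuous R F andb Fc).
exists (CK_lin (-1) e' e); last by move=> u; rewrite /= mulN1r addrC.
exists e, e'; split=> [u|u|u] /=; last by rewrite mulN1r addrC.
- by case: (_ && _); [right|left].
- by case: (_ && _); [right|left].
Qed.

Lemma midpoint_orbit_dense (R : realType) (G : groupType) (a b : G) :
  countable [set: G] -> free_pair a b -> act_dense (@midpoint_orbit R G a b).
Proof.
move=> Gc fab sigma sa k gs fs e e0.
have [al [p [[al1 alM alc] pc psurj pV]]] :=
  coinduced_action Gc fab letter_actK letter_act_ucont.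
(* [amplify_near] doubles the modulus, and e / 2 stays strictly below e. *)
have e40 : 0 < e / 4 by rewrite divr_gt0.
have [n1 fs1] := common_modulus fs k e40.
have [n2 fs2] := common_modulus (fun i => sigma (gs i) (fs i)) k e40.
pose n := maxn n1 n2.
have ra := amplify_action sa al1 alM alc n.
exists (amplify sa alc n); split; last first.
  split=> // i ik; apply: le_lt_trans (@amplify_near _ _ _ _ _ _ _ _ _ (e / 4) _ _) _.
  - by move=> x y xy; apply: (fs1 i ik); apply: agree_le xy; rewrite leq_maxl.
  - by move=> x y xy; apply: (fs2 i ik); apply: agree_le xy; rewrite leq_maxr.
  - by lra.
split=> //.
have Fc := ucont_comp pc (rpart_ucont n).
have [f If fE] := signed_bit_CK R Fc.
have [h Ih hE] := signed_bit_CK R (ucont_comp (letter_act_ucont (true, true)) Fc).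
have [m Im mE] := signed_bit_CK R (ucont_comp (letter_act_ucont (false, true)) Fc).
have S0 : supn (fun _ : cantor_space => 0 : R) < 1.
  by apply: le_lt_trans ltr01; apply: supn_le => x; rewrite normr0.
exists f, h, m; split=> //.
(* Where p gives only true bits, the flip turns the value -1 into 1. *)
- move=> fh; have [l pl] := psurj (fun=> true).
  have : sval f (mix n l l) = sval h (mix n l l) by rewrite fh.
  rewrite fE hE /= rpart_mix pl /signed_bit /letter_act /=.
  by lra.
- move=> u; rewrite fE hE mE /=; move: (p _) => x.
  rewrite /signed_bit /letter_act /=.
  by case: (x 0%N); case: (x 1%N); case: (x 2%N) => /=; lra.
- rewrite (_ : (fun x => _) = fun=> 0)//; apply/funext => u.
  rewrite (@amplify_rpart _ _ _ sa _ alc n a f (fun l => signed_bit R (p l)) fE) mE /=.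
  by rewrite -[a^-1%g]/(eval_letter a b (false, true)) pV subrr.
- rewrite (_ : (fun x => _) = fun=> 0)//; apply/funext => u.
  rewrite (@amplify_rpart _ _ _ sa _ alc n b f (fun l => signed_bit R (p l)) fE) hE /=.
  by rewrite -[b^-1%g]/(eval_letter a b (true, true)) pV subrr.
Qed.

Theorem theorem6p5 (R : realType) (G : groupType) :
  countable [set: G] -> contains_F2 G ->
  act_comeager [set rho : G -> CK R -> CK R | is_action rho /\ ~ admits_inv_sc_norm rho].
Proof.
(* A single dense open set suffices, hence the constant sequence. *)
move=> Gc [a [b fab]]; exists (fun=> midpoint_orbit a b); split=> [_|rho ra U].
  by split; [exact: midpoint_orbit_open|exact: midpoint_orbit_dense].
by split=> //; exact: midpoint_orbit_no_norm (U 0%N).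
Qed.
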